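(* Let $X$ and $Y$ be Banach spaces, and let $A:D(A)\subset X\to X$ and $B:D(B)\subset Y\to Y$ be similar linear operators. Then $A$ is non-negative if and only if $B$ is non-negative.
   Context: $A$ and $B$ are called similar if there is an isometric isomorphism $T:X\to Y$ such that $B=TAT^{-1}$, with domain $D(B)=\{x\in Y:T^{-1}x\in D(A)\}$. A linear operator $A:D(A)\subset X\to X$ on a Banach space $X$ is non-negative if for every $\lambda>0$ the operator $\lambda+A:D(A)\to X$ is bijective with bounded inverse, and $\sup_{\lambda>0}\|\lambda(\lambda+A)^{-1}\|<\infty$. *)

(* Defs.v *)
From mathcomp Require Import all_boot all_order all_algebra.
From mathcomp Require Import all_classical all_reals all_analysis.
From mathcomp Require Import complex.
Set Implicit Arguments.
Unset Strict Implicit.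
Unset Printing Implicit Defensive.
Import Order.TTheory GRing.Theory Num.Theory.
Import numFieldNormedType.Exports.
Local Open Scope classical_set_scope.
Local Open Scope ring_scope.

(* The scalar field of a Banach space is either the field of real numbers or
   the field of complex numbers. In [R[i]], norms are real elements, the order
   [x <= y] means that [y - x] is a non-negative real, and hence [0 < l] ranges
   exactly over the positive reals. *)
Inductive real_or_complex (R : realType) : numFieldType -> Prop :=
| real_scalars : real_or_complex R R
| complex_scalars : real_or_complex R R[i].

(* A linear operator [A : D(A) -> X] with [D(A)] a linear subspace of [X]. The
   values of the underlying total function outside of [D(A)] are irrelevant. *)
Record linear_operator (K : numFieldType) (X : normedModType K) :=
  LinearOperator {
  op_fun :> X -> X;
  op_dom : set X;
  op_dom0 : op_dom 0;
  op_dom_linear : forall (a : K) (x y : X), op_dom x -> op_dom y ->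
    op_dom (a *: x + y);
  op_linear : forall (a : K) (x y : X), op_dom x -> op_dom y ->
    op_fun (a *: x + y) = a *: op_fun x + op_fun y
}.

Definition isometric_isomorphism (K : numFieldType) (X Y : normedModType K)
    (T : {linear X -> Y}) (Tinv : Y -> X) : Prop :=
  [/\ cancel T Tinv, cancel Tinv T & forall x : X, `|T x| = `|x|].

Definition similar_operators (K : numFieldType) (X Y : normedModType K)
    (A : linear_operator X) (B : linear_operator Y) : Prop :=
  exists (T : {linear X -> Y}) (Tinv : Y -> X),
    [/\ isometric_isomorphism T Tinv,
        op_dom B = [set y | op_dom A (Tinv y)] &
        forall y, op_dom B y -> B y = T (A (Tinv y))].

(* [ereal_sup] is only available over a [realFieldType]; this is the same
   definition over a possibly partially ordered [K]. It is only applied to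
   nonempty sets of non-negative elements of [\bar K], which have a least upper
   bound when [K] is the field of real or complex numbers: see [esupP]. *)
Definition esup (K : numFieldType) (S : set (\bar K)) : \bar K :=
  supremum -oo%E S.

Lemma esupP (R : realType) (K : numFieldType) (S : set (\bar K)) :
  real_or_complex R K -> S !=set0 -> (forall x, S x -> (0 <= x)%E) ->
  supremums S (esup S).
Proof.
move=> hK [x0 Sx0] S0.
have [phi [phi_le phi_surj]] : exists phi : \bar R -> \bar K,
    (forall x y, (phi x <= phi y)%E = (x <= y)%E) /\
    (forall z, (0 <= z)%E -> exists x, z = phi x).
  case: hK => [|]; first by exists id; split => // z _; exists z.
  exists (fun x => match x with
    | r%:E => (r%:C)%C%:E | +oo => +oo | -oo => -oo end)%E; split.
    move=> [x||] [y||] //=.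
    - by rewrite !lee_fin lecR.
    - by rewrite [RHS]leey; apply/complex_realP; exists x.
    - by rewrite [RHS]leNye; apply/complex_realP; exists y.
  move=> [[a b]||] //=; last by exists +oo%E.
  by rewrite lee_fin lecE /= => /andP[/eqP -> _]; exists a%:E.
rewrite /esup /supremum; case: ifPn => [/eqP S_eq0|_].
  by rewrite S_eq0 in Sx0.
apply: (@xgetPex _ -oo%E (supremums S)).
exists (phi (ereal_sup [set x | S (phi x)])); split=> [z Sz|z ubz].
  have [x zE] := phi_surj _ (S0 _ Sz).
  by rewrite zE phi_le; apply: ereal_sup_ubound; rewrite /= -zE.
have [y yE] := phi_surj _ (le_trans (S0 _ Sx0) (ubz _ Sx0)).
rewrite yE in ubz *.
by rewrite phi_le; apply: ge_ereal_sup => x Sx; rewrite -phi_le; apply: ubz.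
Qed.

Definition opnorm (K : numFieldType) (X : normedModType K) (S : X -> X)
    : \bar K :=
  esup [set (`|S x|)%:E | x in [set x : X | `|x| <= 1]].

Definition shift_operator (K : numFieldType) (X : normedModType K)
    (A : linear_operator X) (l : K) : X -> X :=
  fun x => l *: x + A x.

(* This is the inverse of [l + A : D(A) -> X] when the latter is bijective. *)
Definition resolvent (K : numFieldType) (X : normedModType K)
    (A : linear_operator X) (l : K) : X -> X :=
  'pinv_(fun=> 0) (op_dom A) (shift_operator A l).

Definition nonnegative_operator (K : numFieldType) (X : normedModType K)
    (A : linear_operator X) : Prop :=
  (forall l : K, 0 < l ->
     set_bij (op_dom A) [set: X] (shift_operator A l) /\
     (opnorm (resolvent A l) < +oo)%E) /\
  (esup [set opnorm (fun x : X => l *: resolvent A l x)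
        | l in [set l : K | (0 < l)%R]] < +oo)%E.

(* Main.v *)
Require Import Defs.
From HB Require Import structures.
From mathcomp Require Import all_boot all_order all_algebra.
From mathcomp Require Import all_classical all_reals all_analysis.
Set Implicit Arguments.
Unset Strict Implicit.
Unset Printing Implicit Defensive.

(** Non-negativity is phrased through the resolvents of the operator and their
    operator norms only. Conjugation by an isometric isomorphism [T] carries
    [l + A] to [l + B], because [T] is linear; hence it carries the bijectivity
    of [l + A] to that of [l + B] ([shift_operator_bij]) and the resolvents of
    [A] to those of [B] ([resolvent_conj]). Since [T] maps the unit ball onto
    the unit ball and preserves norms, conjugate maps have equal operator norms
    ([opnorm_conj]), so both boundedness conditions compare the same extended
    numbers. As similarity is symmetric ([similar_operators_sym]), one
    implication gives the equivalence. *)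

Import Order.TTheory GRing.Theory Num.Theory.
Import numFieldNormedType.Exports.
Local Open Scope classical_set_scope.
Local Open Scope ring_scope.

Lemma isometric_isomorphism_inv_norm (K : numFieldType) (X Y : normedModType K)
    (T : {linear X -> Y}) (Tinv : Y -> X) (y : Y) :
  isometric_isomorphism T Tinv -> `|Tinv y| = `|y|.
Proof. by move=> [_ TinvK Tnorm]; rewrite -Tnorm TinvK. Qed.

Lemma similar_operators_sym (K : numFieldType) (X Y : normedModType K)
    (A : linear_operator X) (B : linear_operator Y) :
  similar_operators A B -> similar_operators B A.
Proof.
move=> [T [Tinv [isoT domB BE]]]; have [TK TinvK Tnorm] := isoT.
pose Tinv_lin : {linear Y -> X} := HB.pack Tinv
  (GRing.isLinear.Build _ _ _ _ _ (GRing.can2_linear TK TinvK)).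
have domBT x : op_dom B (T x) = op_dom A x by rewrite domB /= TK.
exists Tinv_lin, T; split=> /=.
- by split=> // y; exact: isometric_isomorphism_inv_norm isoT.
- by apply/funext => x /=; rewrite domBT.
- by move=> x Ax; rewrite BE ?domBT// !TK.
Qed.

(** [T] maps the unit ball of [X] onto that of [Y], and [S' (T x) = T (S x)] has
    the norm of [S x], so the two suprema are taken over the same set. *)
Lemma opnorm_conj (K : numFieldType) (X Y : normedModType K)
    (T : {linear X -> Y}) (Tinv : Y -> X) (S : X -> X) (S' : Y -> Y) :
  isometric_isomorphism T Tinv -> (forall y, S' y = T (S (Tinv y))) ->
  opnorm S' = opnorm S.
Proof.
move=> isoT S'E; have [TK TinvK Tnorm] := isoT.
congr esup; apply/seteqP; split=> _ [x /= x1 <-].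
- exists (Tinv x); first by rewrite /= (isometric_isomorphism_inv_norm _ isoT).
  by rewrite S'E Tnorm.
- by exists (T x); rewrite /= ?S'E ?TK Tnorm.
Qed.

Section conjugate_operators.
Variables (K : numFieldType) (X Y : normedModType K).
Variables (A : linear_operator X) (B : linear_operator Y).
Variables (T : {linear X -> Y}) (Tinv : Y -> X).
Hypothesis isoT : isometric_isomorphism T Tinv.
Hypothesis domB : op_dom B = [set y | op_dom A (Tinv y)].
Hypothesis BE : forall y, op_dom B y -> B y = T (A (Tinv y)).

Lemma shift_operator_conj (l : K) (y : Y) : op_dom B y ->
  shift_operator B l y = T (shift_operator A l (Tinv y)).
Proof.
have [_ TinvK _] := isoT.
by move=> By; rewrite /shift_operator linearD linearZ/= TinvK BE.
Qed.

Lemma shift_operator_bij (l : K) :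
  set_bij (op_dom A) [set: X] (shift_operator A l) ->
  set_bij (op_dom B) [set: Y] (shift_operator B l).
Proof.
have [TK TinvK _] := isoT => -[_ injA surjA]; split=> //.
- move=> y z /set_mem By /set_mem Bz; rewrite !shift_operator_conj//.
  move=> /(can_inj TK) /injA yz; apply: (can_inj TinvK); apply: yz.
  + by rewrite inE; move: By; rewrite domB.
  + by rewrite inE; move: Bz; rewrite domB.
- move=> y _; have [x Ax xE] := surjA (Tinv y) I.
  have BTx : op_dom B (T x) by rewrite domB /= TK.
  by exists (T x) => //; rewrite shift_operator_conj// TK xE TinvK.
Qed.

(** Both sides lie in the domain of [B] and are sent to [y] by the injective
    [l + B]. *)
Lemma resolvent_conj (l : K) (y : Y) :
  set_bij (op_dom A) [set: X] (shift_operator A l) ->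
  resolvent B l y = T (resolvent A l (Tinv y)).
Proof.
move=> bijA; have bijB := shift_operator_bij bijA.
have [TK TinvK _] := isoT.
have [_ _ surjA] := bijA; have [_ injB surjB] := bijB.
have [domRA _ _] := bijpinv_bij (fun=> 0) bijA.
have [domRB _ _] := bijpinv_bij (fun=> 0) bijB.
have BT : op_dom B (T (resolvent A l (Tinv y))).
  by rewrite domB /= TK; exact: domRA.
apply: injB; rewrite ?inE//; first exact: domRB.
rewrite [RHS]shift_operator_conj// TK /resolvent.
by rewrite (surjpK _ surjB) ?inE// (surjpK _ surjA) ?inE// TinvK.
Qed.

Lemma nonnegative_operator_conj :
  nonnegative_operator A -> nonnegative_operator B.
Proof.
move=> [bijA supA]; split=> [l l0|].
- have [bijAl normAl] := bijA l l0; split; first exact: shift_operator_bij.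
  rewrite (opnorm_conj isoT (S := resolvent A l))// => y.
  exact: resolvent_conj.
- congr (esup _ < _)%E : supA; apply: eq_imagel => l /= l0.
  have [bijAl _] := bijA l l0; apply/esym/(opnorm_conj isoT) => y.
  by rewrite resolvent_conj// linearZ.
Qed.

End conjugate_operators.

Theorem proposition9 (R : realType) (K : numFieldType)
  (hK : real_or_complex R K) (X Y : completeNormedModType K)
  (A : linear_operator X) (B : linear_operator Y) :
  similar_operators A B -> (nonnegative_operator A <-> nonnegative_operator B).
Proof.
move=> simAB; split.
- by have [T [Tinv [isoT domB BE]]] := simAB; exact: nonnegative_operator_conj BE.
- have [T [Tinv [isoT domA AE]]] := similar_operators_sym simAB.
  exact: nonnegative_operator_conj AE.
Qed.
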